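(* For every weak composition $a=(a_1,\dots,a_\ell)$, \[\sum_{T\in\mathrm{SSKD}(a)} q^{\mathrm{maj}(T)}X^{\mathrm{wt}(T)}=\sum_{T\in\mathrm{SKD}(a)} q^{\mathrm{maj}(T)}\,\mathfrak{F}_{\mathrm{des}(T)}(X).\] (The left side is the specialized nonsymmetric Macdonald polynomial $E_a(X;q,0)$.)
   Context: $X=x_1,\dots,x_\ell$. Key diagram of $a$: cells $(r,j)$, $1\le r\le\ell$, $1\le j\le a_r$, rows numbered bottom to top; $N=a_1+\dots+a_\ell$. A filling assigns positive integers to cells; standard means bijective onto $\{1,\dots,N\}$. $\mathrm{wt}(T)$ has $i$th part the number of entries $i$; $X^b=\prod x_i^{b_i}$. Attacking: same column, or adjacent columns with the left cell strictly higher. Non-attacking: no two attacking cells equal and no column-1 entry exceeds its row index. Leg of $(r,j)$ is $a_r-j+1$; $\mathrm{maj}(T)=\sum$ of legs of cells $(r,j)$, $j\ge2$, whose entry is strictly greater than that of $(r,j-1)$. Type I triple: $\{L=(r,j),R=(r,j+1),U=(s,j)\}$, $s>r$, $a_r>a_s$. Type II triple: $\{L=(r,j),R=(r,j+1),B=(s,j+1)\}$, $s<r$, $a_r\ge a_s$. Order the cells by entries, regarding $R$ as smaller than $L$ if their entries are equal. Type I is a co-inversion triple if the increasing order is $(L,R,U),(R,U,L)$ or $(U,L,R)$; Type II is a co-inversion triple if it is $(L,R,B),(R,B,L)$ or $(B,L,R)$. $\mathrm{SSKD}(a)$: non-attacking fillings with entries in $\{1,\dots,\ell\}$ and no co-inversion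 triples. $\mathrm{SKD}(a)$ (standard key tabloids): standard fillings with no co-inversion triples (not required to be non-attacking). Weak descent composition of a standard filling $T$: split $N,N-1,\dots,1$ into blocks $\tau^{(k)}|\cdots|\tau^{(1)}$ (left to right, $\tau^{(k)}$ containing $N$), breaking between $i+1$ and $i$ exactly when the cell of $i+1$ is in a column weakly right of the cell of $i$. Let $m_i$ be the largest element of $\tau^{(i)}$. Put $t_k=$ row of $m_k$ if $m_k$ is in column 1, else $t_k=\ell$; for $i<k$, $t_i=\min(\mathrm{row}(m_i),t_{i+1}-1)$ if $m_i$ is in column 1, else $t_i=t_{i+1}-1$. If all $t_i>0$, $\mathrm{des}(T)$ is the weak composition of length $\ell$ with part $|\tau^{(i)}|$ in position $t_i$ and zeros elsewhere; otherwise $\mathrm{des}(T)=\varnothing$. Fundamental slide polynomial: for weak compositions, $b\ge c$ means $b_1+\dots+b_k\ge c_1+\dots+c_k$ for all $k$; $\mathrm{flat}(c)$ deletes zero parts; a composition $\beta$ refines $\alpha=(\alpha_1,\dots,\alpha_p)$ if there are $i_1<\dots<i_p$ with $\beta_1+\dots+\beta_{i_j}=\alpha_1+\dots+\alpha_j$ for all $j$. Then $\mathfrak{F}_c(X)=\sum X^b$ over weak compositions $b$ of length $\ell$ with $b\ge c$ and $\mathrm{flat}(b)$ refining $\mathrm{flat}(c)$; and $\mathfrak{F}_\varnothing=0$. *)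

(* Defs.v *)
From mathcomp Require Import all_boot all_order all_algebra.
From mathcomp Require Import mpoly.

Set Implicit Arguments.
Unset Strict Implicit.
Unset Printing Implicit Defensive.

Import Order.TTheory GRing.Theory Num.Theory.

Local Open Scope nat_scope.

(* Weak compositions of length l are the exponent vectors 'X_{1..l}; the
   monomial X^b is 'X_[b], and mdeg b is the sum of the parts.  Ordinals count
   from 0, whereas row, col and entry below count from 1. *)

Section KeyDiagram.
Variables (l : nat) (a : 'X_{1..l}).

Definition cell := {r : 'I_l & 'I_(a r)}.

Definition row (c : cell) : nat := (tag c).+1.
Definition col (c : cell) : nat := (tagged c).+1.
Definition rowlen (c : cell) : nat := a (tag c).
(* The truncated subtraction is harmless, as col c <= rowlen c. *)
Definition leg (c : cell) : nat := rowlen c - col c + 1.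

(* Quantified over ordered pairs in nonattacking: in the second disjunct c is
   the left cell. *)
Definition attacking (c d : cell) : bool :=
  (c != d) &&
  ((col c == col d) || ((col d == (col c).+1) && (row d < row c))).

Definition type1_triple (L R U : cell) : bool :=
  [&& row R == row L, col R == (col L).+1,
      col U == col L, row L < row U & rowlen U < rowlen L].

Definition type2_triple (L R B : cell) : bool :=
  [&& row R == row L, col R == (col L).+1,
      col B == (col L).+1, row B < row L & rowlen B <= rowlen L].

Section Filling.
Variables (n : nat) (T : {ffun cell -> 'I_n}).

Definition entry (c : cell) : nat := (T c).+1.

Definition wt : 'X_{1..n} := [multinom #|[set c | T c == i]| | i < n].

Definition nonattacking : bool :=
  [forall c, forall d, attacking c d ==> (entry c != entry d)] &&
  [forall c, (col c == 1) ==> (entry c <= row c)].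

Definition standard : bool :=
  injectiveb T && [forall i, exists c, T c == i].

Definition left_descent (c : cell) : bool :=
  [exists d, [&& row d == row c, (col d).+1 == col c & entry d < entry c]].

Definition maj : nat := \sum_(c | left_descent c) leg c.

(* The third cell is U for a type I triple and B for a type II triple.  On a
   tie between L and R the cell R comes first, so L precedes R only when its
   entry is strictly smaller.  The third cell attacks both L and R, so neither
   in a non-attacking nor in a standard filling is there any other tie. *)
Definition coinversion (L R X : cell) : bool :=
  [|| entry L < entry R < entry X,
      entry R < entry X < entry L
    | entry X < entry L < entry R].

Definition no_coinversion_triple : bool :=
  [forall L, forall R, forall X,
     (type1_triple L R X || type2_triple L R X) ==> ~~ coinversion L R X].

(* When T is standard, this lists the cells containing N, N-1, ..., 1. *)
Definition reading : seq cell :=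
  sort (fun c d => entry d <= entry c) (enum {: cell}).

End Filling.

(* tau^(k), ..., tau^(1), each integer being replaced by the cell containing
   it; there is a break between consecutive c, d when c is weakly right of d. *)
Fixpoint descent_blocks (s : seq cell) : seq (seq cell) :=
  if s is c :: s' then
    if descent_blocks s' is (d :: b) :: bs then
      if col d <= col c then [:: c] :: (d :: b) :: bs
      else (c :: d :: b) :: bs
    else [:: [:: c]]
  else [::].

(* t_k, from the cell of m_k. *)
Definition first_position (c : cell) : int :=
  if col c == 1 then Posz (row c) else Posz l.

(* t_i, from t_(i+1) and the cell of m_i. *)
Definition next_position (t : int) (c : cell) : int :=
  if col c == 1 then Order.min (Posz (row c)) (t - 1)%R else (t - 1)%R.

(* t_k, ..., t_1, from the cells of m_k, ..., m_1. *)
Definition positions (ms : seq cell) : seq int :=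
  if ms is c :: ms' then
    let t := first_position c in t :: scanl next_position t ms'
  else [::].

(* None stands for the empty descent composition.  The largest element of a
   block is its first one, so pmap ohead lists the cells of the m_i. *)
Definition des (n : nat) (T : {ffun cell -> 'I_n}) : option 'X_{1..l} :=
  let taus := descent_blocks (reading T) in
  let ts := positions (pmap ohead taus) in
  if all (fun t : int => 0 < t)%R ts then
    Some [multinom sumn [seq size p.2 | p <- zip ts taus & p.1 == Posz i.+1]
         | i < l]
  else None.

Definition SSKD : {set {ffun cell -> 'I_l}} :=
  [set T | nonattacking T && no_coinversion_triple T].

Definition SKD : {set {ffun cell -> 'I_(mdeg a)}} :=
  [set T | standard T && no_coinversion_triple T].

End KeyDiagram.

Definition dominates (l : nat) (b c : 'X_{1..l}) : bool :=
  [forall k : 'I_l,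
     \sum_(i < l | i <= k) c i <= \sum_(i < l | i <= k) b i].

Definition flat (l : nat) (c : 'X_{1..l}) : seq nat :=
  [seq x <- [seq c i | i <- enum 'I_l] | x != 0].

(* As usual for refinement, the two compositions have the same sum; the
   equations on partial sums alone would allow beta to have further parts
   after the last index. *)
Definition refines (beta alpha : seq nat) : bool :=
  (sumn beta == sumn alpha) &&
  [exists i : {ffun 'I_(size alpha) -> 'I_(size beta)},
     [forall j : 'I_(size alpha), forall k : 'I_(size alpha),
        (j < k) ==> (i j < i k)] &&
     [forall j : 'I_(size alpha),
        sumn (take (i j).+1 beta) == sumn (take j.+1 alpha)]].

(* The degree bound only makes the index type finite: refinement forces
   mdeg b = mdeg c. *)
Definition slide (R : nzRingType) (l : nat) (c : 'X_{1..l}) : {mpoly R[l]} :=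
  (\sum_(b : 'X_{1..l < (mdeg c).+1}
         | dominates b c && refines (flat b) (flat c)) 'X_[b])%R.

Definition slide_opt (R : nzRingType) (l : nat) (c : option 'X_{1..l}) :
    {mpoly R[l]} :=
  if c is Some c' then slide R c' else 0%R.

(* Main.v *)
Require Import Defs.
From mathcomp Require Import all_boot all_order all_algebra.
From mathcomp Require Import mpoly zify.
(* row and col are those of key diagrams, not of matrices. *)
Import Defs.
Import GRing.Theory.

(* Standardize a semistandard filling S by numbering its cells in increasing
   order of entry, equal entries being numbered from right to left.  This keeps
   maj and the co-inversion triples, so it maps SSKD a to SKD a, and it remains
   to identify the weight generating function of the fiber over T.  The
   non-attacking condition within a fiber reduces to its part on column 1: if
   two attacking cells had equal entries, then T would have a co-inversion
   triple.  Hence S is determined by its weight b, through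
   S c <= k <-> T c <= b_1 + ... + b_k, and b occurs exactly when its partial
   sums hit every break of the descent word of T and are large enough at the
   rows of the column 1 cells.  The upper bounds that these conditions force on
   the entries of the blocks are the positions t_i, and in terms of them the
   conditions say that flat b refines flat (des T) and that b dominates des T. *)

Set Implicit Arguments.
Unset Strict Implicit.
Unset Printing Implicit Defensive.

Local Open Scope nat_scope.

(** * Partial sums and slide polynomials *)

Definition cum l (b : 'X_{1..l}) (j : nat) := \sum_(i < l | i < j) b i.

Definition hit (B : nat -> nat) (m : nat) := exists k, B k = m.

Section PartialSums.
Variable l : nat.
Implicit Types b c : 'X_{1..l}.

Lemma cum0 b : cum b 0 = 0.
Proof. by rewrite /cum big_pred0. Qed.

Lemma cum_oversize b j : l <= j -> cum b j = mdeg b.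
Proof.
move=> lj; rewrite /cum mdegE; apply: eq_bigl => i.
by rewrite (leq_trans (ltn_ord i)).
Qed.

Lemma leq_cum b j k : j <= k -> cum b j <= cum b k.
Proof.
move=> jk; rewrite /cum [X in _ <= X](bigID (fun i : 'I_l => i < j)) /=.
rewrite (eq_bigl (fun i : 'I_l => (i < k) && (i < j))) ?leq_addr // => i.
by case: ltnP => [/leq_trans->|] //; rewrite andbF.
Qed.

Lemma cum_leq_mdeg b j : cum b j <= mdeg b.
Proof. by rewrite -(cum_oversize b (leq_maxr j l)) leq_cum ?leq_maxl. Qed.

Lemma cumS b (j : 'I_l) : cum b j.+1 = cum b j + b j.
Proof.
rewrite /cum (bigD1 j) //= addnC; congr (_ + _).
by apply: eq_bigl => i; rewrite ltnS -val_eqE /=; lia.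
Qed.

Lemma cum_inj b c : cum b =1 cum c -> b = c.
Proof.
move=> bc; apply/mnmP => i.
by have := cumS b i; rewrite !bc cumS => /addnI.
Qed.

Lemma sumn_take_cum b j :
  sumn (take j [seq b i | i <- enum 'I_l]) = cum b j.
Proof.
have size_s : size [seq b i | i <- enum 'I_l] = l by rewrite size_map size_enum_ord.
have small k : k <= l -> sumn (take k [seq b i | i <- enum 'I_l]) = cum b k.
  elim: k => [|k IH] kl; first by rewrite take0 cum0.
  rewrite (take_nth 0) ?size_s // sumn_rcons (IH (ltnW kl)).
  rewrite (nth_map (Ordinal kl)) ?size_enum_ord //.
  by rewrite -[k.+1]/((Ordinal kl).+1) cumS (nth_ord_enum _ (Ordinal kl)).
case: (leqP j l) => [/small//|/ltnW lj].
by rewrite take_oversize ?size_s // cum_oversize // -(cum_oversize b (leqnn l))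
  -small // take_oversize ?size_s.
Qed.

(** With the next lemma: deleting zero parts keeps the set of partial sums, so refinement of
    [flat b] can be read off [cum b]. *)
Lemma sumn_take_nonzero (s : seq nat) j :
  exists k, sumn (take k [seq x <- s | x != 0]) = sumn (take j s).
Proof.
elim: s j => [|x s IH] [|j]; try by exists 0; rewrite !take0.
have [k /= Hk] := IH j.
case: eqP => [->|_] /=; first by exists k; rewrite Hk.
by exists k.+1; rewrite /= Hk.
Qed.

Lemma sumn_take_with_zeros (s : seq nat) j :
  exists k, sumn (take k s) = sumn (take j [seq x <- s | x != 0]).
Proof.
elim: s j => [|x s IH] j; first by exists 0; rewrite take0.
rewrite /=; case: eqP => [->|_] /=.
  by have [k Hk] := IH j; exists k.+1.
case: j => [|j]; first by exists 0; rewrite !take0.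
by have [k Hk] := IH j; exists k.+1; rewrite /= Hk.
Qed.

Lemma leq_sumn_take (s : seq nat) j k :
  j <= k -> sumn (take j s) <= sumn (take k s).
Proof.
elim: s j k => [|x s IH] [|j] [|k] //= jk.
by rewrite leq_add2l IH.
Qed.

Lemma ltn_sumn_take (s : seq nat) j k :
  all (fun x => x != 0) s -> k <= size s -> j < k ->
  sumn (take j s) < sumn (take k s).
Proof.
elim: s j k => [|x s IH] [|j] [|k] //= /andP[x0 s0] ks jk; first by lia.
by rewrite ltn_add2l IH.
Qed.

(** As [alpha] has no zero part, its partial sums strictly increase, so indices chosen separately
    for each [j] are automatically increasing. *)
Lemma refinesP (beta alpha : seq nat) :
  all (fun x => x != 0) alpha ->
  reflect (sumn beta = sumn alpha /\
           forall j, exists i, sumn (take i beta) = sumn (take j alpha))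
          (refines beta alpha).
Proof.
move=> alpha0; apply: (iffP andP) => [[/eqP sums /existsP[f /andP[_ /forallP fP]]]|].
  split=> // j.
  case: j => [|j]; first by exists 0; rewrite !take0.
  case: (ltnP j (size alpha)) => [jlt|jge].
    by have /eqP <- := fP (Ordinal jlt); eexists.
  by exists (size beta); rewrite take_size take_oversize // ltnW.
case=> sums Hex; split; first exact/eqP.
have pick (j : 'I_(size alpha)) :
    exists i : 'I_(size beta), sumn (take i.+1 beta) == sumn (take j.+1 alpha).
  have [i Hi] := Hex j.+1.
  have pos : 0 < sumn (take j.+1 alpha).
    by have := ltn_sumn_take alpha0 (ltn_ord j) (ltn0Sn j); rewrite take0.
  case: i Hi => [|i] Hi; first by rewrite take0 in Hi; rewrite -Hi in pos.
  case: (ltnP i (size beta)) => [ilt|ige].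
    by exists (Ordinal ilt); apply/eqP.
  (* Past the end of [beta] the partial sum is the total, which its last index also gives. *)
  have b0 : 0 < size beta by case: (beta) Hi pos => //= <-.
  have ilt : (size beta).-1 < size beta by rewrite prednK.
  exists (Ordinal ilt); rewrite /= prednK // -Hi take_size take_oversize //.
  exact: ltnW.
apply/existsP; exists [ffun j => xchoose (pick j)].
apply/andP; split; last first.
  by apply/forallP => j; rewrite ffunE; apply: (xchooseP (pick j)).
apply/forallP => j; apply/forallP => k; apply/implyP => jk; rewrite !ffunE.
rewrite ltnNge; apply/negP => le_kj.
have := @ltn_sumn_take _ j.+1 k.+1 alpha0 (ltn_ord k) jk.
rewrite -(eqP (xchooseP (pick j))) -(eqP (xchooseP (pick k))) ltnNge.
by rewrite leq_sumn_take.
Qed.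

Lemma dominatesP b c :
  reflect (forall j, cum c j <= cum b j) (dominates b c).
Proof.
apply: (iffP forallP) => [dom j|dom k]; last exact: dom k.+1.
case: (leqP j l) => [|/ltnW lj].
  by case: j => [_|j jl]; [rewrite !cum0|apply: (dom (Ordinal jl))].
(* Beyond [l] the sums are totals, which [dominates] compares at its last index; for [l = 0] both
   are 0. *)
rewrite !cum_oversize //; case: (posnP l) => [l0|l0].
  by rewrite -!(@cum_oversize _ 0) ?l0 // !cum0.
rewrite -!(cum_oversize _ (leqSpred l)).
have ll : l.-1 < l by rewrite prednK.
exact: (dom (Ordinal ll)).
Qed.

Lemma sumn_flat b : sumn (flat b) = mdeg b.
Proof.
rewrite -(cum_oversize b (leqnn l)) -sumn_take_cum take_oversize; last first.
  by rewrite size_map size_enum_ord.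
rewrite /flat; elim: [seq _ | _ <- _] => //= x s <-.
by case: eqP => [->|].
Qed.

(** The fibers of standardization are described by partial sums, so slide monomials are put in the
    same terms. *)
Lemma slide_termP b c :
  reflect [/\ mdeg b = mdeg c, forall j, cum c j <= cum b j
              & forall j, hit (cum b) (cum c j)]
          (dominates b c && refines (flat b) (flat c)).
Proof.
have flat0 : all (fun x => x != 0) (flat c) by apply: filter_all.
apply: (iffP andP).
  move=> [/dominatesP dom /(refinesP _ flat0)]; rewrite !sumn_flat.
  case=> degs ref; split=> // j; rewrite -sumn_take_cum.
  have [k <-] := sumn_take_nonzero [seq c i | i <- enum 'I_l] j.
  have [i <-] := ref k.
  have [k' <-] := sumn_take_with_zeros [seq b i | i <- enum 'I_l] i.
  by exists k'; rewrite sumn_take_cum.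
case=> degs dom hits; split; first exact/dominatesP.
apply/(refinesP _ flat0); rewrite !sumn_flat; split=> // j.
have [k <-] := sumn_take_with_zeros [seq c i | i <- enum 'I_l] j.
rewrite sumn_take_cum; have [i <-] := hits k; rewrite -sumn_take_cum.
exact: sumn_take_nonzero.
Qed.

End PartialSums.

(** * Descent blocks and their positions *)

Section DescentBlocks.
Variables (l : nat) (a : 'X_{1..l}).
Implicit Types (s : seq (cell a)) (bs : seq (seq (cell a))) (us : seq nat).

Lemma descent_blocks_neq_nil s : [::] \notin descent_blocks s.
Proof.
elim: s => //= c s; case: (descent_blocks s) => [|[|d t] bs] //=.
by case: ifP; rewrite !inE.
Qed.

Lemma flatten_descent_blocks s : flatten (descent_blocks s) = s.
Proof.
elim: s => //= c s; have := descent_blocks_neq_nil s.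
case: (descent_blocks s) => [|[|d t] bs] //= _ <- //.
by case: ifP.
Qed.

Lemma descent_blocks_cons s :
  s = [::] \/ exists d t bs, descent_blocks s = (d :: t) :: bs.
Proof.
have := flatten_descent_blocks s; have := descent_blocks_neq_nil s.
case: (descent_blocks s) => [|[|d t] bs] //= _ <-; first by left.
by right; exists d, t, bs.
Qed.

(** With a fictitious position [l.+1] before the first block, [t_k] obeys the rule of the other
    [t_i], because a row index is at most [l]. *)
Lemma positions_scanl (ms : seq (cell a)) :
  positions ms = scanl (@next_position l a) (Posz l.+1) ms.
Proof.
case: ms => //= c ms.
suff -> : first_position c = next_position (Posz l.+1) c by [].
rewrite /first_position /next_position; have := ltn_ord (tag c).
rewrite -/(row c); case: ifP => _; lia.
Qed.

Lemma next_position_lt (t : int) (c : cell a) : (next_position t c < t)%R.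
Proof. by rewrite /next_position; case: ifP => _; lia. Qed.

Lemma path_scanl_positions (ms : seq (cell a)) (u : nat) us :
  scanl (@next_position l a) (Posz u) ms = map Posz us -> path gtn u us.
Proof.
elim: ms u us => [|c ms IH] u [|v us] //= [Ev Eus].
rewrite (IH v us) ?andbT -?Ev //.
by have := next_position_lt (Posz u) c; rewrite Ev; lia.
Qed.

(* When us lists the positions of the blocks bs of T, this is the sum of the
   first j parts of des T. *)
Definition weight_upto us bs (j : nat) : nat :=
  sumn [seq size p.2 | p <- zip us bs & p.1 <= j].

Lemma weight_upto_all us bs j :
  size us = size bs -> all (geq j) us -> weight_upto us bs j = size (flatten bs).
Proof.
rewrite /weight_upto; elim: us bs => [|u us IH] [|t bs] //= [Es] /andP[uj usj].
by rewrite uj /= size_cat IH.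
Qed.

Section Bounded.
Variable B : nat -> nat.
Hypotheses (B0 : B 0 = 0) (leB : {homo B : j k / j <= k}).

(* For s the reading word of T and B the partial sums of b: the conditions on b
   to be the weight of a filling with standardization T.  In the two variants
   below they are expressed on the blocks of s and on their positions. *)
Fixpoint word_bounded s : Prop :=
  if s is c :: s' then
    [/\ col c = 1 -> size s <= B (row c),
        (if s' is d :: _ then col d <= col c -> hit B (size s') else True)
      & word_bounded s']
  else True.

Fixpoint blocks_bounded bs : Prop :=
  if bs is t :: bs' then
    [/\ (if t is c :: _ then col c = 1 -> size (flatten bs) <= B (row c)
         else True),
        hit B (size (flatten bs'))
      & blocks_bounded bs']
  else True.

Fixpoint fits us bs : Prop :=
  if us is u :: us' then
    if bs is _ :: bs' then
      [/\ size (flatten bs) <= B u, hit B (size (flatten bs')) & fits us' bs']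
    else True
  else True.

(** Columns strictly increase along a block, so only its first cell can lie in column 1. The last
    block adds the condition [hit B 0], which [B0] grants. *)
Lemma word_blocks_bounded s :
  word_bounded s <-> blocks_bounded (descent_blocks s).
Proof.
elim: s => //= c s IH; case: (descent_blocks_cons s) => [->|].
  by split=> [[h _ _]|[h _ _]]; split=> //=; exists 0.
move=> [d [t [bs E]]]; have := flatten_descent_blocks s.
move: IH; rewrite {}E => + Es; rewrite -{s}Es /= => IH.
case: ifP => cd /=; split=> -[h1 h2 h3].
- by split=> //; [apply: h2|apply/IH].
- by split=> //; apply/IH.
- by case/IH: h3.
- by split=> //; apply/IH; split=> // d1; move: cd; rewrite d1.
Qed.

(* Going down the blocks, hitting the total size M' of the remaining ones at a
   value k forces k < t, because B t >= M > M'; hence B (t - 1) >= M', which is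
   what lets the bound t - 1 enter the next position. *)
Lemma blocks_bounded_fits u bs :
  [::] \notin bs -> size (flatten bs) <= B u ->
  blocks_bounded bs <->
  exists us, [/\ scanl (@next_position l a) (Posz u.+1) (pmap ohead bs)
                 = map Posz us,
                 all (ltn 0) us & fits us bs].
Proof.
elim: bs u => [|[|c t] bs IH] //= u; first by split=> // _; exists [::].
rewrite inE /= => bs0 leBu; split.
  move=> [rowB [k Bk] bsB].
  (* The minimum in [next_position] satisfies the bound because both of its arguments do. *)
  have [v Ev leBv] : exists2 v, next_position (Posz u.+1) c = Posz v
                            & size (c :: t ++ flatten bs) <= B v.
    rewrite /next_position; case: eqP => [c1|_]; last by exists u => //; lia.
    have := rowB c1; case: (leqP (row c) u) => ru leBr.
      by exists (row c) => //; lia.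
    by exists u => //; lia.
  (* The block is nonempty and [B 0 = 0], which forces a positive position. *)
  have v0 : 0 < v by case: v leBv {Ev} => //; rewrite B0.
  have kv : k < v.
    rewrite ltnNge; apply/negP => /leB; rewrite Bk => /(leq_trans leBv).
    by rewrite /= size_cat; lia.
  have leBv1 : size (flatten bs) <= B v.-1 by rewrite -Bk leB //; lia.
  have [us [Eus us0 usf]] := (IH v.-1 bs0 leBv1).1 bsB.
  exists (v :: us); split=> /=; [by rewrite Ev -Eus prednK|by rewrite v0|].
  by split=> //; exists k.
move=> [[|v us] [//= [Ev Eus] /andP[v0 us0] [leBv [k Bk] usf]]].
have kv : k < v.
  rewrite ltnNge; apply/negP => /leB; rewrite Bk => /(leq_trans leBv).
  by rewrite /= size_cat; lia.
have leBv1 : size (flatten bs) <= B v.-1 by rewrite -Bk leB //; lia.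
split; first 2 last.
- by apply/(IH v.-1 bs0 leBv1); exists us; rewrite prednK // -Ev.
- move=> c1; apply: leq_trans leBv _; apply: leB.
  by move: Ev; rewrite /next_position c1 /=; lia.
- by exists k.
Qed.

(** As [us] decreases, [weight_upto us bs] is a step function that can jump only at the positions,
    and its values are the sizes of the final segments of [bs]. Since [B] is monotone, comparing at
    the jumps suffices. The total size does not occur among the hits in [fits], hence the last
    hypothesis. *)
Lemma fits_weight_upto v us bs :
  size us = size bs -> path gtn v us -> all (ltn 0) us ->
  hit B (size (flatten bs)) ->
  fits us bs <->
  (forall j, weight_upto us bs j <= B j) /\
  (forall j, hit B (weight_upto us bs j)).
Proof.
elim: us bs v => [|u us IH] [|t bs] v //=.
move=> [Es] /andP[uv us_lt] /andP[u0 us0] hitM.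
have us_u : all (gtn u) us by apply: order_path_min us_lt => x y z /=; lia.
have high j : u <= j -> weight_upto us bs j = size (flatten bs).
  move=> uj; apply: weight_upto_all => //; apply: sub_all us_u => x /=; lia.
(* Just below [u] the first block no longer counts, while all later ones still do. *)
have high1 : weight_upto us bs u.-1 = size (flatten bs).
  by apply: weight_upto_all => //; apply: sub_all us_u => x /=; lia.
have Ew j : weight_upto (u :: us) (t :: bs) j =
    if u <= j then size (t ++ flatten bs) else weight_upto us bs j.
  by rewrite size_cat {1}/weight_upto /=; case: ifP => //= /high <-.
split.
  move=> [leBu hitbs]; move/(IH bs u Es us_lt us0 hitbs) => [le_w hit_w].
  split=> j; rewrite Ew; case: ifP => // uj.
  by apply: leq_trans leBu _; apply: leB.
move=> [le_w hit_w].
have u1 : (u <= u.-1) = false by lia.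
have hitbs : hit B (size (flatten bs)) by have := hit_w u.-1; rewrite Ew u1 high1.
split=> //; first by have := le_w u; rewrite Ew leqnn.
apply/(IH bs u Es us_lt us0 hitbs); split=> j.
  case: (leqP u j) => uj; last by have := le_w j; rewrite Ew (leqNgt u) uj.
  rewrite high // -high1; have := le_w u.-1; rewrite Ew u1 => /leq_trans -> //.
  by apply: leB; lia.
case: (leqP u j) => uj; first by rewrite high.
by have := hit_w j; rewrite Ew (leqNgt u) uj.
Qed.

End Bounded.

End DescentBlocks.

Lemma cum_positions l (X : Type) (z : seq (nat * seq X)) j :
  all (fun p => 0 < p.1 <= l) z ->
  cum [multinom sumn [seq size p.2 | p <- z & p.1 == i.+1] | i < l] j
  = sumn [seq size p.2 | p <- z & p.1 <= j].
Proof.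
rewrite /cum; elim: z => [|p z IH] /=.
  by move=> _; rewrite big1 // => i _; rewrite mnmE.
move=> /andP[/andP[p0 pl] zl]; transitivity
  ((if p.1 <= j then size p.2 else 0)
   + sumn [seq size p.2 | p <- z & p.1 <= j]); last by case: ifP.
rewrite -IH // (eq_bigr (fun i : 'I_l =>
   (if p.1 == i.+1 then size p.2 else 0) +
   [multinom sumn [seq size p.2 | p <- z & p.1 == i.+1] | i < l] i)); last first.
  by move=> i _; rewrite !mnmE; case: ifP.
rewrite big_split /=; congr (_ + _); rewrite -big_mkcondr /=.
have pl1 : p.1.-1 < l by rewrite prednK.
rewrite (eq_bigl (fun i : 'I_l => (i == Ordinal pl1) && (p.1 <= j))); last first.
  by move=> i; rewrite -val_eqE /=; lia.
by case: ifP => _; [under eq_bigl do rewrite andbT; rewrite big_pred1_eq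
                   |rewrite big_pred0 // => i; rewrite andbF].
Qed.

(** * Reading words of standard fillings *)

Lemma rev_iotaS n : rev (iota 0 n.+1) = n :: rev (iota 0 n).
Proof. by rewrite -addn1 iotaD rev_cat. Qed.

Section Filling.
Variables (l : nat) (a : 'X_{1..l}).

Lemma card_cell : #|{: cell a}| = mdeg a.
Proof.
rewrite card_tagged sumnE big_map big_enum mdegE /=.
by apply: eq_bigr => i _; rewrite card_ord.
Qed.

Variable T : {ffun cell a -> 'I_(mdeg a)}.

Lemma size_reading : size (reading T) = mdeg a.
Proof. by rewrite size_sort -card_cell cardE. Qed.

Lemma des_from_positions (us : seq nat) :
  let taus := descent_blocks (reading T) in
  positions (pmap ohead taus) = map Posz us -> all (ltn 0) us ->
  exists2 c, des T = Some c & cum c =1 weight_upto us taus.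
Proof.
move=> taus Eus us0; rewrite /des -/taus Eus all_map us0.
eexists; first reflexivity.
(* The positions decrease strictly from the fictitious [l.+1]. *)
have us_l : all (geq l) us.
  rewrite positions_scanl in Eus; have := path_scanl_positions Eus.
  move/(order_path_min (fun x y z xy yz => ltn_trans yz xy)).
  by apply: sub_all => u /=; rewrite ltnS.
move=> j; transitivity (cum [multinom sumn [seq size p.2 | p <- zip us taus
                                           & p.1 == i.+1] | i < l] j); last first.
  apply: cum_positions; elim: (us) (taus) us0 us_l => [|u us' IH] [|t bs] //=.
  by move=> /andP[-> us0] /andP[-> us_l]; apply: IH.
congr (cum _ j); apply/mnmP => i; rewrite !mnmE; congr sumn.
elim: (us) (taus) => [|u us' IH] [|t bs] //=.
by rewrite eqz_nat; case: ifP => _ /=; rewrite IH.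
Qed.

(** Chains the translations from word to blocks, to positions, to partial sums of [des T]. The
    initial bound is [l], where [cum b] reaches the whole degree. *)
Lemma word_bounded_des (b : 'X_{1..l}) :
  mdeg b = mdeg a /\ word_bounded (cum b) (reading T) <->
  exists2 c, des T = Some c & dominates b c && refines (flat b) (flat c).
Proof.
set taus := descent_blocks (reading T).
have size_taus : size (flatten taus) = mdeg a.
  by rewrite flatten_descent_blocks size_reading.
have taus0 : [::] \notin taus by apply: descent_blocks_neq_nil.
have hit_top : mdeg b = mdeg a -> hit (cum b) (size (flatten taus)).
  by move=> Eb; exists l; rewrite cum_oversize // Eb.
have size_us us : positions (pmap ohead taus) = map Posz us ->
    size us = size taus.
  move=> /(congr1 size); rewrite positions_scanl size_scanl size_map => <-.
  rewrite size_pmap; apply/eqP; rewrite -all_count; apply/allP => t.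
  by case: t => // /(negP taus0).
have leB := @leq_cum l b; have bounded_fits := @blocks_bounded_fits _ a _ (cum0 b) leB.
have fits_weights us : positions (pmap ohead taus) = map Posz us ->
    all (ltn 0) us -> mdeg b = mdeg a -> fits (cum b) us taus <->
    (forall j, weight_upto us taus j <= cum b j) /\
    (forall j, hit (cum b) (weight_upto us taus j)).
  move=> Eus us0 Eb; apply: (fits_weight_upto (cum0 b) leB (v := l.+1)) => //.
  - exact: size_us.
  - by rewrite positions_scanl in Eus; apply: path_scanl_positions Eus.
  - exact: hit_top.
have size_le : mdeg b = mdeg a -> size (flatten taus) <= cum b l.
  by move=> Eb; rewrite cum_oversize // Eb size_taus.
have mdeg_c us (c : 'X_{1..l}) : positions (pmap ohead taus) = map Posz us ->
    cum c =1 weight_upto us taus -> mdeg c = mdeg a.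
  move=> Eus Ec; rewrite -(cum_oversize c (leqnn l)) Ec -size_taus.
  apply: weight_upto_all; first exact: size_us.
  rewrite positions_scanl in Eus; have := path_scanl_positions Eus.
  move/(order_path_min (fun x y z xy yz => ltn_trans yz xy)).
  by apply: sub_all => u /=; rewrite ltnS.
split.
  move=> [Eb /(word_blocks_bounded (cum0 b))].
  case/(bounded_fits _ _ taus0 (size_le Eb)) => us [].
  rewrite -positions_scanl => Eus us0 /(fits_weights us Eus us0 Eb)[dom hits].
  have [c Edes Ec] := des_from_positions Eus us0; exists c => //.
  apply/slide_termP; split; first by rewrite Eb (mdeg_c us).
    by move=> j; rewrite Ec.
  by move=> j; rewrite Ec.
move=> [c Edes /slide_termP[Ebc dom hits]].
have [us Eus us0] : exists2 us, positions (pmap ohead taus) = map Posz us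
                              & all (ltn 0) us.
  move: Edes; rewrite /des -/taus; case: ifP => // ts0 _.
  (* All positions are positive, so [absz] changes only their type. *)
  exists (map absz (positions (pmap ohead taus))).
    elim: (positions _) ts0 => //= t ts IH /andP[t0 /IH <-].
    by congr (_ :: _); lia.
  by rewrite all_map; apply: sub_all ts0 => t /=; lia.
have [c' Edes' Ec] := des_from_positions Eus us0.
move: Edes; rewrite Edes' => -[E]; rewrite {c'}E in Edes' Ec.
have Eb : mdeg b = mdeg a by rewrite Ebc (mdeg_c us).
split=> //; apply/(word_blocks_bounded (cum0 b)).
apply/(bounded_fits _ _ taus0 (size_le Eb)); exists us.
split=> //; first by rewrite -positions_scanl.
by apply/(fits_weights us Eus us0 Eb); split=> j; rewrite -Ec.
Qed.

Hypothesis stdT : standard T.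

Lemma standard_inj : injective T.
Proof. by case/andP: stdT => /injectiveP. Qed.

Lemma standard_surj i : exists c, T c = i.
Proof. by case/andP: stdT => _ /forallP/(_ i)/existsP[c /eqP <-]; exists c. Qed.

Lemma card_lt_standard m : m <= mdeg a -> #|[set d | T d < m]| = m.
Proof.
move=> mN; rewrite -(card_imset _ standard_inj).
have -> : T @: [set d | T d < m] = [set widen_ord mN i | i : 'I_m].
  apply/setP => i; apply/imsetP/imsetP => [[d]|[j _ ->]].
    by rewrite inE => lt ->; exists (Ordinal lt) => //; apply/val_inj.
  have [d Ed] := standard_surj (widen_ord mN j).
  by exists d; rewrite ?inE ?Ed /=.
rewrite card_imset ?card_ord // => i j /(congr1 val) /= ij.
exact: val_inj.
Qed.

Lemma reading_labels :
  [seq T c : nat | c <- reading T] = rev (iota 0 (mdeg a)).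
Proof.
have -> : [seq T c : nat | c <- reading T]
    = sort geq [seq T c : nat | c <- enum {: cell a}].
  by rewrite sort_map.
apply: (sorted_eq (leT := geq)).
- by move=> x y z /=; lia.
- by move=> x y /=; lia.
- by apply: sort_sorted => x y /=; lia.
- by rewrite rev_sorted iota_sorted.
rewrite perm_sort perm_sym perm_rev; apply: uniq_perm.
- exact: iota_uniq.
- rewrite map_inj_uniq ?enum_uniq // => c d /val_inj; exact: standard_inj.
move=> i; rewrite mem_iota /= add0n; apply/idP/mapP => [iN|[c _ ->]] //.
by have [c Ec] := standard_surj (Ordinal iN); exists c; rewrite ?mem_enum ?Ec.
Qed.

(** The label of the first cell is the number of cells after it, so the sizes in [word_bounded] turn
    into labels and neighbours in the word are cells with consecutive labels. *)
Lemma word_bounded_labels (B : nat -> nat) (s : seq (cell a)) :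
  [seq T c : nat | c <- s] = rev (iota 0 (size s)) ->
  word_bounded B s <->
  {in s, forall c, col c = 1 -> T c < B (row c)} /\
  {in s &, forall c d, T d = (T c).+1 :> nat -> col c <= col d ->
                       hit B (T d)}.
Proof.
elim: s => [|c s IH]; first by [].
rewrite rev_iotaS map_cons => -[Tc Es].
have Tlt e : e \in s -> T e < T c.
  move=> es; have : (T e : nat) \in [seq T c : nat | c <- s] by apply: map_f.
  by rewrite Es mem_rev mem_iota -Tc.
split.
  move=> [rowc brk /(IH Es)[rows brks]]; split.
    by move=> e; rewrite inE => /orP[/eqP-> /rowc|/rows]; rewrite ?Tc.
  move=> e d; rewrite !inE => /orP[/eqP->|es] /orP[/eqP->|ds].
  - by lia.
  - by have := Tlt d ds; lia.
  - move=> Te cd; move: brk Tc Es; case: (s) es => // f s' es brk Tc.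
    rewrite rev_iotaS map_cons => -[Tf _].
    have Ef : f = e by apply/standard_inj/val_inj => /=; rewrite Tf; lia.
    by rewrite Tc; apply: brk; rewrite Ef.
  - exact: brks.
move=> [rows brks]; split.
- by move=> /rows; rewrite inE eqxx Tc; apply.
- move: Tc Es brks; case: (s) => // f s' Tc.
  rewrite rev_iotaS map_cons => -[Tf _] brks cd.
  have := brks f c; rewrite !inE !eqxx orbT Tf Tc => /(_ isT isT erefl cd).
  exact.
- apply/(IH Es); split=> [e es|e d es ds].
    by apply: rows; rewrite inE es orbT.
  by apply: brks; rewrite inE ?es ?ds orbT.
Qed.

Lemma word_bounded_reading (B : nat -> nat) :
  word_bounded B (reading T) <->
  (forall c, col c = 1 -> T c < B (row c)) /\
  (forall c d, T d = (T c).+1 :> nat -> col c <= col d -> hit B (T d)).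
Proof.
have memr c : c \in reading T by rewrite mem_sort mem_enum.
rewrite word_bounded_labels ?size_reading ?reading_labels //.
split=> -[rows brks]; split.
- by move=> c; apply: rows.
- by move=> c d; apply: brks.
- by move=> c _; apply: rows.
- by move=> c d _ _; apply: brks.
Qed.

End Filling.

(** * Standardization *)

Section Standardization.
Variables (l : nat) (a : 'X_{1..l}).
Implicit Types (S : {ffun cell a -> 'I_l}) (T : {ffun cell a -> 'I_(mdeg a)}).

(* Strict order of the labels of S, ties being broken as between R and L in the
   definition of co-inversion triples. *)
Definition precedes S (c d : cell a) : bool :=
  (S c < S d) || ((S c == S d) && (col d < col c)).

Lemma precedesxx S c : precedes S c c = false.
Proof. by rewrite /precedes !ltnn andbF. Qed.

Lemma precedes_trans S : transitive (precedes S).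
Proof. by move=> c d e; rewrite /precedes -!val_eqE /=; lia. Qed.

Lemma nonattackingP S :
  reflect ((forall c d, attacking c d -> S c <> S d) /\
           (forall c, col c = 1 -> S c < row c))
          (nonattacking S).
Proof.
apply: (iffP andP) => -[H1 H2]; split.
- move=> c d att Scd; move: H1 => /forallP/(_ c)/forallP/(_ d).
  by rewrite att /= /entry Scd eqxx.
- by move=> c /eqP c1; move: H2 => /forallP/(_ c); rewrite c1.
- apply/forallP => c; apply/forallP => d; apply/implyP => att.
  by apply/negP => /eqP [] /val_inj; apply: H1.
- by apply/forallP => c; apply/implyP => /eqP; apply: H2.
Qed.

(** Distinct incomparable cells would share both entry and column, hence attack each other. *)
Lemma precedes_total S c d :
  nonattacking S -> c != d -> precedes S c d || precedes S d c.
Proof.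
move=> /nonattackingP[nonatt _] cd.
have := nonatt c d; rewrite /attacking cd /= => {}nonatt.
rewrite /precedes -!val_eqE /=.
case: (ltngtP (S c) (S d)) => //= /val_inj Scd.
case: (ltngtP (col c) (col d)) nonatt => //= _ /(_ isT).
by rewrite Scd.
Qed.

Lemma card_precedes_lt S c : #|[set d | precedes S d c]| < mdeg a.
Proof.
rewrite -card_cell -cardsT; apply: proper_card; apply/properP; split=> //.
by exists c; rewrite ?inE ?precedesxx.
Qed.

Definition standardization S : {ffun cell a -> 'I_(mdeg a)} :=
  [ffun c => Ordinal (card_precedes_lt S c)].

(** The facts below are proved from this relation because, in a fiber, [S] is built from [T] and not
    conversely. *)
Definition standardizes T S := forall c d, (T c < T d) = precedes S c d.

Lemma standardization_mono S c d :
  precedes S c d -> standardization S c < standardization S d.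
Proof.
move=> cd; rewrite !ffunE /=; apply: proper_card; apply/properP; split.
  by apply/subsetP => e; rewrite !inE => /precedes_trans; apply.
by exists c; rewrite !inE ?precedesxx.
Qed.

Lemma standardizationP S :
  nonattacking S -> standardizes (standardization S) S.
Proof.
move=> nonatt c d; apply/idP/idP; last exact: standardization_mono.
move=> lt_cd; have cd : c != d by apply: contraTneq lt_cd => ->; rewrite ltnn.
case/orP: (precedes_total nonatt cd) => // /standardization_mono.
by rewrite ltnNge ltnW.
Qed.

Lemma standardization_standard S :
  nonattacking S -> standard (standardization S).
Proof.
move=> nonatt.
have inj : injective (standardization S).
  move=> c d Ecd; apply/eqP; apply/negPn/negP => cd.
  by case/orP: (precedes_total nonatt cd) => /standardization_mono;
    rewrite Ecd ltnn.
apply/andP; split; first exact/injectiveP.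
apply/forallP => i; apply/existsP.
have : i \in codom (standardization S).
  by apply: inj_card_onto => //; rewrite card_ord card_cell.
by case/codomP => c ->; exists c.
Qed.

Lemma standardization_uniq T S :
  standard T -> standardizes T S -> standardization S = T.
Proof.
move=> stdT TS; apply/ffunP => c; apply/val_inj; rewrite ffunE /=.
rewrite -[RHS](card_lt_standard stdT (ltnW (ltn_ord (T c)))).
by congr #|pred_of_set _|; apply/setP => d; rewrite !inE TS.
Qed.

(** Ties favour the cell further right, so a cell weakly to the left comes first only if strictly
    smaller. Descents and pairs [L], [R] are compared in this way. *)
Lemma standardizes_row T S c d : standardizes T S -> (col c <= col d) ->
  (T c < T d) = (S c < S d).
Proof. by move=> -> cd; rewrite /precedes (ltnNge (col d)) cd /= andbF orbF. Qed.

Lemma standardizes_maj T S : standardizes T S -> maj T = maj S.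
Proof.
move=> TS; apply: eq_bigl => c; apply: eq_existsb => d; rewrite /entry !ltnS.
case: eqP => //= _; case: eqP => //= cd.
by apply: standardizes_row => //; lia.
Qed.

Lemma cell_neq (c d : cell a) : (row c != row d) || (col c != col d) -> c != d.
Proof. by apply: contraTneq => ->; rewrite !eqxx. Qed.

Lemma triple_attacking (L R X : cell a) :
  type1_triple L R X || type2_triple L R X ->
  [/\ col R = (col L).+1, attacking L X || attacking X L
    & attacking R X || attacking X R].
Proof.
move=> trip; have neqLX : L != X.
  by apply: cell_neq; case/orP: trip => /and5P[*]; lia.
have neqRX : R != X.
  by apply: cell_neq; case/orP: trip => /and5P[*]; lia.
rewrite /attacking (eq_sym X L) (eq_sym X R) neqLX neqRX /=.
by case/orP: trip => /and5P[*]; split; lia.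
Qed.

(** Only ties could change. The third cell is in attacking position with both others, so only [L]
    and [R] can tie, and [precedes] breaks that tie as [coinversion] does. *)
Lemma standardizes_no_coinversion T S :
  nonattacking S -> standardizes T S ->
  no_coinversion_triple T = no_coinversion_triple S.
Proof.
move=> /nonattackingP[nonatt _] TS.
have neq c d : attacking c d || attacking d c -> (T c < T d) = (S c < S d).
  move=> cd; rewrite TS /precedes; case: eqP => [Scd|_]; last by rewrite orbF.
  by case/orP: cd => /nonatt; rewrite Scd.
apply: eq_forallb => L; apply: eq_forallb => R; apply: eq_forallb => X.
case: (boolP (_ || _)) => //= /triple_attacking[cR LX RX].
rewrite /coinversion /entry !ltnS (neq R X) //.
rewrite (neq X L); last by rewrite orbC.
by rewrite (standardizes_row TS) // cR.
Qed.

Lemma cell_in_row (c : cell a) (j : nat) : 0 < j <= rowlen c ->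
  exists e : cell a, [/\ row e = row c, col e = j & rowlen e = rowlen c].
Proof.
case: c => r i; rewrite /rowlen /= => /andP[j0 jr].
have jlt : j.-1 < a r by rewrite prednK.
by exists (Tagged (fun r => 'I_(a r)) (Ordinal jlt)); rewrite /col /= prednK.
Qed.

Lemma col_in_row (c : cell a) : 0 < col c <= rowlen c.
Proof. exact: ltn_ord. Qed.

(* If cells attacking each other from adjacent columns had equal entries in S,
   no label of T would lie between theirs, and either the left neighbour of the
   right cell or the right neighbour of the left cell would complete a
   co-inversion triple of T. *)
Lemma standardizes_attacking T S c d :
  standard T -> no_coinversion_triple T -> standardizes T S ->
  attacking c d -> S c <> S d.
Proof.
move=> stdT noT TS /andP[cd att] Scd.
have noT' L R X : type1_triple L R X || type2_triple L R X ->
    ~~ coinversion T L R X.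
  by move: noT => /forallP/(_ L)/forallP/(_ R)/forallP/(_ X)/implyP.
have Tneq e f : e != f -> T e != T f :> nat.
  by apply: contra => /eqP/val_inj/(standard_inj stdT)->.
case/orP: att => [/eqP ccd|/andP[/eqP cd1 rdc]].
  have := Tneq _ _ cd; rewrite neq_ltn !TS /precedes Scd eqxx ltnn ccd ltnn.
  by [].
have ltT : T d < T c by rewrite TS /precedes Scd eqxx cd1 ltnSn orbT.
(* Such an [e] would have the common entry and a column strictly between two adjacent ones. *)
have between e : ~~ (T d < T e < T c).
  by rewrite !TS /precedes -!val_eqE /= Scd; lia.
have [d0 dr] := andP (col_in_row d); have [c0 cr] := andP (col_in_row c).
(* If the row of [c] is shorter, [c] is the cell [U] of a type I triple; otherwise [d] is the cell
   [B] of a type II triple. By [between], the label of the added cell is below or above both others,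
   and each case is a co-inversion. *)
case: (ltnP (rowlen c) (rowlen d)) => lens.
  have [|L [rL cL lL]] := @cell_in_row d (col c); first lia.
  have neqLd : T L != T d :> nat by apply/Tneq/cell_neq; lia.
  have neqLc : T L != T c :> nat by apply/Tneq/cell_neq; lia.
  have := noT' L d c; rewrite /type1_triple /coinversion /entry.
  by have := between L; lia.
have [|R [rR cR lR]] := @cell_in_row c (col d); first lia.
have neqRd : T R != T d :> nat by apply/Tneq/cell_neq; lia.
have neqRc : T R != T c :> nat by apply/Tneq/cell_neq; lia.
have := noT' c R d; rewrite /type2_triple /coinversion /entry.
by have := between R; lia.
Qed.

(** * Recovering a filling from its standardization and weight *)

Lemma cum_wt S k : cum (wt S) k = #|[set c | S c < k]|.
Proof.
rewrite -sum1dep_card (partition_big S (fun i => i < k)) //=.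
apply: eq_bigr => i ik; rewrite mnmE -sum1dep_card; apply: eq_bigl => c.
by case: eqP => [->|]; rewrite ?ik ?andbF.
Qed.

Lemma mdeg_wt S : mdeg (wt S) = mdeg a.
Proof.
rewrite -(cum_oversize (wt S) (leqnn l)) cum_wt -card_cell -cardsT.
by congr #|pred_of_set _|; apply/setP => c; rewrite !inE ltn_ord.
Qed.

(** The cells with entries below a given bound form an initial segment in the order of [T], and
    [cum (wt S)] counts them. *)
Lemma standardizes_ltn_cum T S c k : standard T -> standardizes T S ->
  (S c < k) = (T c < cum (wt S) k).
Proof.
move=> stdT TS; rewrite cum_wt; apply/idP/idP => [Sck|].
  rewrite -(card_lt_standard stdT (ltn_ord (T c))); apply/subset_leq_card.
  apply/subsetP => d; rewrite !inE ltnS leq_eqVlt => /orP[/eqP|].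
    by move=> /val_inj/(standard_inj stdT)->.
  by rewrite TS /precedes -val_eqE /=; lia.
rewrite ltnNge; apply: contraNT; rewrite -leqNgt => kSc.
rewrite -[X in _ <= X](card_lt_standard stdT (ltnW (ltn_ord (T c)))).
apply/subset_leq_card/subsetP => d; rewrite !inE TS /precedes.
by move=> /leq_trans->.
Qed.

Lemma standardizes_word_bounded T S :
  standard T -> nonattacking S -> standardizes T S ->
  word_bounded (cum (wt S)) (reading T).
Proof.
move=> stdT /nonattackingP[_ rows] TS; apply/(word_bounded_reading stdT).
split=> [c c1|c d Td cd]; first by rewrite -standardizes_ltn_cum // rows.
have Scd : S c < S d by rewrite -(standardizes_row TS cd) Td.
(* The labels below [T d] are exactly those of the cells with entry below that of [d]. *)
exists (S d); apply/eqP; rewrite eqn_leq leqNgt {2}Td.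
by rewrite -!(standardizes_ltn_cum _ _ stdT TS) ltnn Scd.
Qed.

(** By [standardizes_ltn_cum] this is the only candidate of weight [b] over [T]: the entry of [c] is
    the first index at which [cum b] exceeds [T c]. *)
Lemma filling_of_cum T (b : 'X_{1..l}) : mdeg b = mdeg a ->
  exists S, forall c k, (S c < k) = (T c < cum b k).
Proof.
move=> Eb; pose f c := find (fun k => T c < cum b k.+1) (iota 0 l).
have l0 (c : cell a) : 0 < l by apply: leq_ltn_trans (ltn_ord (tag c)).
have hasf c : has (fun k => T c < cum b k.+1) (iota 0 l).
  apply/hasP; exists l.-1; first by rewrite mem_iota /= prednK ?l0.
  by rewrite prednK ?(l0 c) // cum_oversize // Eb.
have fl c : f c < l by move: (hasf c); rewrite has_find size_iota.
exists [ffun c => Ordinal (fl c)] => c k; rewrite ffunE /=.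
apply/idP/idP => [fk|Tk].
  have := nth_find 0 (hasf c); rewrite nth_iota ?fl // add0n => /leq_trans.
  by apply; apply: leq_cum.
rewrite ltnNge; apply/negP => kf; case: k => [|k] in Tk kf *.
  by rewrite cum0 in Tk.
have := before_find 0 kf; rewrite nth_iota ?Tk //.
exact: ltn_trans kf (fl c).
Qed.

Section FillingOfCum.
Variables (T : {ffun cell a -> 'I_(mdeg a)}) (b : 'X_{1..l}).
Variable S : {ffun cell a -> 'I_l}.
Hypothesis stdT : standard T.
Hypothesis SE : forall c k, (S c < k) = (T c < cum b k).

Lemma filling_of_cum_wt : mdeg b = mdeg a -> wt S = b.
Proof.
move=> Eb; apply: cum_inj => k; rewrite cum_wt.
have kN : cum b k <= mdeg a by rewrite -Eb cum_leq_mdeg.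
rewrite -[RHS](card_lt_standard stdT kN).
by congr #|pred_of_set _|; apply/setP => c; rewrite !inE SE.
Qed.

Lemma filling_of_cum_mono c d : T c <= T d -> S c <= S d.
Proof.
move=> cd; rewrite leqNgt SE; apply/negP => /(leq_ltn_trans cd).
by rewrite -SE ltnn.
Qed.

(** Go from [c] to [d] through consecutive labels, all with the same entry. A step that did not move
    strictly left would be a break, which [cum b] hits, and the two entries would differ. *)
Lemma filling_of_cum_col c d : word_bounded (cum b) (reading T) ->
  T c < T d -> S c = S d -> col d < col c.
Proof.
move=> /(word_bounded_reading stdT)[_ brks].
have [m] := ubnP (T d - T c); elim: m c => // m IH c lem lt_cd Scd.
have iN : (T c).+1 < mdeg a by apply: leq_ltn_trans (ltn_ord (T d)).
have [e Te] := standard_surj stdT (Ordinal iN).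
have {}Te : T e = (T c).+1 :> nat by rewrite Te.
have Sce : S c = S e.
  apply/val_inj/eqP; rewrite eqn_leq {2}Scd.
  by rewrite !filling_of_cum_mono // Te.
have ce : col e < col c.
  rewrite ltnNge; apply/negP => /(brks _ _ Te)[k Ek].
  have := SE c k; have := SE e k; rewrite Sce Ek ltnn Te ltnSn => ->.
  by [].
move: lt_cd; rewrite leq_eqVlt -Te => /orP[/eqP/val_inj|lt_ed].
  by move=> /(standard_inj stdT) <-.
by apply: ltn_trans ce; apply: IH => //; [lia|rewrite -Sce].
Qed.

(** One implication suffices, as [T] orders the cells totally and [precedes] is a strict order. *)
Lemma filling_of_cum_standardizes :
  word_bounded (cum b) (reading T) -> standardizes T S.
Proof.
move=> bnd.
have imp c d : T c < T d -> precedes S c d.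
  move=> cd; rewrite /precedes; have := filling_of_cum_mono (ltnW cd).
  rewrite leq_eqVlt => /orP[/eqP/val_inj Scd|->//].
  by rewrite Scd eqxx (filling_of_cum_col bnd cd Scd) orbT.
move=> c d; apply/idP/idP => [/imp //|pcd]; rewrite ltnNge leq_eqVlt.
apply/negP => /orP[/eqP/val_inj/(standard_inj stdT) Ecd|/imp pdc].
  by rewrite Ecd precedesxx in pcd.
by have := precedes_trans pcd pdc; rewrite precedesxx.
Qed.

Lemma filling_of_cum_nonattacking :
  no_coinversion_triple T -> word_bounded (cum b) (reading T) ->
  nonattacking S.
Proof.
move=> noT bnd; apply/nonattackingP; split=> [c d|c c1].
  exact: standardizes_attacking (filling_of_cum_standardizes bnd).
by rewrite SE; have [rows _] := (word_bounded_reading stdT _).1 bnd; apply: rows.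
Qed.

End FillingOfCum.

End Standardization.

(** * Fibers of standardization and the final identity *)

Lemma standardization_SKD l (a : 'X_{1..l}) (S : {ffun cell a -> 'I_l}) :
  S \in SSKD a -> standardization S \in SKD a.
Proof.
rewrite !inE => /andP[nonatt noS].
rewrite standardization_standard //=.
by rewrite (standardizes_no_coinversion nonatt (standardizationP nonatt)).
Qed.

(** On the fiber over [T] the weight is injective, and its image is the set of exponents of the
    slide polynomial. *)
Lemma sum_standardization_fiber (R : nzRingType) l (a : 'X_{1..l})
    (T : {ffun cell a -> 'I_(mdeg a)}) :
  T \in SKD a ->
  (\sum_(S in SSKD a | standardization S == T) 'X_[wt S]
   = slide_opt R (des T))%R.
Proof.
rewrite inE => /andP[stdT noT].
have fiberP S : (S \in SSKD a) && (standardization S == T) ->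
    standardizes T S /\
    exists2 c, des T = Some c & dominates (wt S) c && refines (flat (wt S)) (flat c).
  rewrite inE => /andP[/andP[nonatt _] /eqP ET].
  have TS : standardizes T S by rewrite -ET; apply: standardizationP.
  split=> //; apply/word_bounded_des; rewrite mdeg_wt; split=> //.
  exact: standardizes_word_bounded.
case Edes: (des T) => [c|] /=; last first.
  by rewrite big1 // => S /fiberP[_ []]; rewrite Edes.
have fiber_slide S : (S \in SSKD a) && (standardization S == T) ->
    dominates (wt S) c && refines (flat (wt S)) (flat c).
  by move=> /fiberP[_ [c']]; rewrite Edes => -[<-].
(* The default of [insubd] never occurs on the fiber, where weights have degree [mdeg c]. *)
pose w (S : {ffun cell a -> 'I_l}) : 'X_{1..l < (mdeg c).+1} :=
  insubd (BMultinom (ltnSn (mdeg c))) (wt S).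
have wE S : (S \in SSKD a) && (standardization S == T) -> w S = wt S :> 'X_{1..l}.
  move=> /fiber_slide/slide_termP[Ec _ _].
  by rewrite /w val_insubd Ec ltnSn.
rewrite /slide (partition_big w
  (fun b : 'X_{1..l < (mdeg c).+1} => dominates b c && refines (flat b) (flat c)));
  last by move=> S HS; rewrite wE //; apply: fiber_slide.
apply: eq_bigr => b slide_b.
have [Eb bnd] : mdeg b = mdeg a /\ word_bounded (cum b) (reading T).
  by apply/word_bounded_des; exists c.
have [S SE] := filling_of_cum T Eb.
have TS := filling_of_cum_standardizes stdT SE bnd.
have nonatt := filling_of_cum_nonattacking stdT SE noT bnd.
have wtS := filling_of_cum_wt stdT SE Eb.
have fiberS : (S \in SSKD a) && (standardization S == T).
  rewrite inE nonatt -(standardizes_no_coinversion nonatt TS) noT /=.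
  exact/eqP/standardization_uniq.
(* Another filling [S'] of weight [b] in the fiber satisfies the same threshold conditions as [S],
   so the two agree. *)
rewrite (big_pred1 S) ?wtS // => S'; apply/andP/eqP => [[fiberS' /eqP wS']|->].
  have [TS' _] := fiberP _ fiberS'.
  apply/ffunP => d; apply/val_inj/eqP => /=.
  have agree k : (S' d < k) = (S d < k).
    by rewrite (standardizes_ltn_cum d k stdT TS') SE -(wE S' fiberS') wS'.
  have := agree (S d).+1; have := agree (S' d).+1.
  by rewrite !ltnS !leqnn eqn_leq => <- ->.
by split=> //; apply/eqP/val_inj => /=; rewrite wE.
Qed.

Local Open Scope ring_scope.

(* The parameter q is the variable 'X of the coefficient ring {poly int}. *)
Theorem theorem3p6 (l : nat) (a : 'X_{1..l}) :
  \sum_(T in SSKD a) ('X : {poly int}) ^+ maj T *: 'X_[wt T] =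
  \sum_(T in SKD a) ('X : {poly int}) ^+ maj T *: slide_opt {poly int} (des T)
  :> {mpoly {poly int}[l]}.
Proof.
rewrite (partition_big (@standardization l a) (fun T => T \in SKD a)) /=;
  last by move=> S /standardization_SKD.
apply: eq_bigr => T TSKD; rewrite -sum_standardization_fiber // scaler_sumr.
apply: eq_bigr => S /andP[]; rewrite inE => /andP[nonatt _] /eqP <-.
by rewrite (standardizes_maj (standardizationP nonatt)).
Qed.
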